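(* For every non-negative integer $n$ there exist integers $x,y,z,t$ with $$P_8(x)+2P_8(y)+3P_8(z)+6P_8(t)=n,$$ where $P_8(x)=3x^2-2x$. That is, the sum $\Phi_{1,2,3,6}$ of generalized octagonal numbers is universal over $\mathbb{Z}$.
   Context: A generalized octagonal number is an integer of the form $P_8(x)=3x^2-2x$ with $x\in\mathbb{Z}$. For positive integers $a_1,\dots,a_k$, $\Phi_{a_1,\dots,a_k}(x_1,\dots,x_k)=a_1P_8(x_1)+\cdots+a_kP_8(x_k)$; it is called universal over $\mathbb{Z}$ if the equation $\Phi_{a_1,\dots,a_k}(x_1,\dots,x_k)=n$ has an integer solution for every non-negative integer $n$. *)

(* Defs.v *)
From mathcomp Require Import all_boot all_order all_algebra.

Set Implicit Arguments.
Unset Strict Implicit.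
Unset Printing Implicit Defensive.

Import GRing.Theory.
Local Open Scope ring_scope.

(* Generalized octagonal numbers: the argument ranges over all integers. *)
Definition P8 (x : int) : int := 3 * x ^+ 2 - 2 * x.

(* The coefficients are meant to be positive; positivity is not built in. *)
Definition Phi (k : nat) (a : k.-tuple nat) (x : k.-tuple int) : int :=
  \sum_(i < k) (tnth a i)%:Z * P8 (tnth x i).

Definition universal (k : nat) (a : k.-tuple nat) : Prop :=
  forall n : nat, exists x : k.-tuple int, Phi a x = n%:Z.

(* Main.v *)
Require Import Defs.
From mathcomp Require Import all_boot all_order all_algebra.
From mathcomp Require Import zify ring.
Import GRing.Theory Num.Theory.

Local Open Scope ring_scope.

(* Since 3 P8(x) + 1 = (3x - 1)^2, one has to write 3m, for every m >= 4, as
   X^2 + 2Y^2 + 3Z^2 + 6T^2 with all four entries prime to 3.  As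
   (u + 2v)^2 + 2(u - v)^2 = 3(u^2 + 2v^2), it suffices to write
   m = u^2 + z^2 + 2v^2 + 2t^2 with at most one entry divisible by 3.
   Start from four squares with sum m and pair two entries of equal parity, via
   (s + r)^2 + (s - r)^2 = 2s^2 + 2r^2.  A pair (x, w) <> (0, 0) of multiples
   of 3 can be replaced by a pair prime to 3 with the same x^2 + 2w^2.  A good
   choice of the pairing then settles every m, except when the nonzero entries
   are k equal squares, m = k t^2 with k = 1, 2, 3, where t is odd or k = 1.  An
   even square is (2s)^2 = s^2 + s^2 + s^2 + s^2.  If t is odd, then t > 1, so t^2
   is a sum of three squares in a nontrivial way, and
     t^2 = A^2 + B^2 + C^2,   2 t^2 = t^2 + A^2 + B^2 + C^2,
     3 t^2 = (A + B + C)^2 + (A - B)^2 + (A - C)^2 + (B - C)^2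
   are representations of m that are not exceptional. *)

(** * Lagrange's four-square theorem *)

Definition sum4sq (n : int) : Prop :=
  exists a b c d : int, n = a ^+ 2 + b ^+ 2 + c ^+ 2 + d ^+ 2.

(** Euler's identity: multiplicativity of the norm for the product of one quaternion by the
    conjugate of the other, whose real part is the inner product. *)
Lemma sum4sqM (m n : int) : sum4sq m -> sum4sq n -> sum4sq (m * n).
Proof.
move=> [a [b [c [d ->]]]] [e [f [g [h ->]]]].
exists (a * e + b * f + c * g + d * h), (a * f - b * e + c * h - d * g),
  (a * g - c * e + d * f - b * h), (a * h - d * e + b * g - c * f).
by ring.
Qed.

(** Pigeonhole in ['F_p]: the values [i ^ 2] and [- 1 - j ^ 2] for [i, j <= p./2] are indexed by
    [p + 1] elements and each family is injective, so the two families meet. *)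
Lemma prime_dvd_sum2sq_succ (p : nat) : prime p -> odd p ->
  exists i j : nat, [/\ (i <= p./2)%N, (j <= p./2)%N & (p %| i ^ 2 + j ^ 2 + 1)%N].
Proof.
move=> pr_p odd_p; set h := (p./2).+1.
have sqr_inj (i j : 'I_h) : (i%:R ^+ 2 : 'F_p) = j%:R ^+ 2 -> i = j.
  have leh (k : 'I_h) : (k <= p./2)%N by rewrite -ltnS.
  have := leh i; have := leh j => lej lei /eqP; rewrite eqf_sqr => /orP[] /eqP.
    move/(congr1 val); rewrite /= !val_Fp_nat // !modn_small; [|lia|lia].
    exact: val_inj.
  move=> /eqP; rewrite -subr_eq0 opprK -natrD.
  rewrite -(dvdn_pcharf (pchar_Fp pr_p)) => /dvdnP[k Hk].
  by apply: val_inj => /=; case: k Hk => [|k] Hk; [lia|nia].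
pose f (s : 'I_h + 'I_h) : 'F_p :=
  match s with inl i => i%:R ^+ 2 | inr j => - 1 - j%:R ^+ 2 end.
have /injectivePn[s [t nst]] : ~~ injectiveb f.
  apply/injectiveP => /leq_card; rewrite card_sum !card_ord Fp_cast //.
  by rewrite /h; lia.
suff H (i j : 'I_h) : (i%:R ^+ 2 : 'F_p) = -1 - j%:R ^+ 2 ->
    exists i j : nat, [/\ (i <= p./2)%N, (j <= p./2)%N & (p %| i ^ 2 + j ^ 2 + 1)%N].
  case: s t nst => [i|i] [j|j] nst /= E; last 1 first.
  - by move/addrI/oppr_inj/sqr_inj: E nst => ->; rewrite eqxx.
  - by move/sqr_inj: E nst => ->; rewrite eqxx.
  - exact: H E.
  - exact: H (esym E).
move=> E; exists i, j; split; [by rewrite -ltnS|by rewrite -ltnS|].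
by rewrite (dvdn_pcharf (pchar_Fp pr_p)) !natrD !natrX E; apply/eqP; ring.
Qed.

Lemma centered_residue (m x : int) : 0 < m ->
  exists y q : int, [/\ x = y + m * q, - m < 2 * y & 2 * y <= m].
Proof.
move=> m0; set r := (x %% m)%Z; set q := (x %/ m)%Z.
have E : x = q * m + r := divz_eq x m.
have r0 : 0 <= r by apply: modz_ge0; lia.
have rm : r < m by apply: ltz_pmod.
have [le|gt] := lerP (2 * r) m; first by exists r, q; split; lia.
by exists (r - m), (q + 1); split; lia.
Qed.

(** Infinite descent: the centered residues of the entries modulo [m] have squares summing to
    [m * r] with [0 <= r <= m]. Multiplying the two representations and dividing by [m ^ 2]
    represents [r * p]. The extreme cases [r = 0] and [r = m] would make [m] divide [p]. *)
Lemma sum4sq_descent (p m : nat) : prime p -> (0 < m < p)%N ->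
  sum4sq (m%:Z * p%:Z) -> sum4sq p%:Z.
Proof.
move=> pr_p; elim/ltn_ind: m => m IH /andP[m0 mp] [a [b [c [d E]]]].
have [m1|m1] := eqVneq m 1%N.
  by exists a, b, c, d; rewrite -E m1 mul1r.
have ndvd (k : int) : p%:Z = m%:Z * k -> False.
  move=> Ek; have : (m %| p)%N.
    by rewrite -[m]/(`|m%:Z|%N) -[p]/(`|p%:Z|%N) -dvdzE; apply/dvdzP; exists k; rewrite mulrC.
  by case/primeP: pr_p => _ H /H; rewrite (negPf m1) => /eqP; lia.
have mZ : 0 < m%:Z by lia.
have [a' [qa [Ea a1 a2]]] := centered_residue m%:Z a mZ.
have [b' [qb [Eb b1 b2]]] := centered_residue m%:Z b mZ.
have [c' [qc [Ec c1 c2]]] := centered_residue m%:Z c mZ.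
have [d' [qd [Ed d1 d2]]] := centered_residue m%:Z d mZ.
have mN0 : m%:Z != 0 by lia.
(* Expanding [m * p] with [a = a' + m * qa] and so on, then dividing by [m], gives this closed form
   for the sum of the squared residues over [m]. *)
pose r : int := p%:Z - 2 * (a' * qa + b' * qb + c' * qc + d' * qd)
          - m%:Z * (qa ^+ 2 + qb ^+ 2 + qc ^+ 2 + qd ^+ 2).
have Er : m%:Z * r = a' ^+ 2 + b' ^+ 2 + c' ^+ 2 + d' ^+ 2.
  rewrite /r mulrBr mulrBr E Ea Eb Ec Ed; ring.
have sqle (y : int) : - m%:Z < 2 * y -> 2 * y <= m%:Z ->
    4 * y ^+ 2 <= m%:Z ^+ 2 /\ (4 * y ^+ 2 = m%:Z ^+ 2 -> 2 * y = m%:Z).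
  move=> y1 y2; have ge0 : 0 <= (m%:Z - 2 * y) * (m%:Z + 2 * y).
    by apply: mulr_ge0; lia.
  have E4 : (m%:Z - 2 * y) * (m%:Z + 2 * y) = m%:Z ^+ 2 - 4 * y ^+ 2 by ring.
  rewrite E4 in ge0; split; first by lia.
  move=> Ey; rewrite Ey subrr in E4.
  by move/eqP: E4; rewrite mulf_eq0 => /orP[] /eqP; lia.
have [sa ea] := sqle a' a1 a2; have [sb eb] := sqle b' b1 b2.
have [sc ec] := sqle c' c1 c2; have [sd ed] := sqle d' d1 d2.
have r0 : 0 <= r by rewrite -(pmulr_rge0 _ mZ) Er !addr_ge0 ?sqr_ge0.
have rm : r <= m%:Z by rewrite -(ler_pM2l mZ) Er -expr2; clear -sa sb sc sd; lia.
have [rz|rz] := eqVneq r 0.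
  have [za zb zc zd] : [/\ a' = 0, b' = 0, c' = 0 & d' = 0].
    move/eqP: Er; rewrite rz mulr0 eq_sym !paddr_eq0 ?addr_ge0 ?sqr_ge0 //.
    by rewrite !sqrf_eq0 => /andP[/andP[/andP[/eqP-> /eqP->] /eqP->] /eqP->].
  case: (ndvd (qa ^+ 2 + qb ^+ 2 + qc ^+ 2 + qd ^+ 2)).
  have <- : r + m%:Z * (qa ^+ 2 + qb ^+ 2 + qc ^+ 2 + qd ^+ 2) = p%:Z.
    by rewrite /r za zb zc zd; ring.
  by rewrite rz add0r.
have [rmm|rltm] := eqVneq r m%:Z.
  (* All four bounds [4 * y ^+ 2 <= m ^+ 2] are now equalities, so every residue is [m / 2]. *)
  rewrite rmm in Er.
  have {}ea : 2 * a' = m%:Z by apply: ea; clear -sa sb sc sd Er; lia.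
  have {}eb : 2 * b' = m%:Z by apply: eb; clear -sa sb sc sd Er; lia.
  have {}ec : 2 * c' = m%:Z by apply: ec; clear -sa sb sc sd Er; lia.
  have {}ed : 2 * d' = m%:Z by apply: ed; clear -sa sb sc sd Er; lia.
  case: (ndvd (1 + qa + qb + qc + qd + qa ^+ 2 + qb ^+ 2 + qc ^+ 2 + qd ^+ 2)).
  have -> : p%:Z = r + 2 * a' * qa + 2 * b' * qb + 2 * c' * qc + 2 * d' * qd
     + m%:Z * (qa ^+ 2 + qb ^+ 2 + qc ^+ 2 + qd ^+ 2) by rewrite /r; ring.
  by rewrite ea eb ec ed rmm; ring.
have rN : r = `|r|%N%:Z by rewrite gez0_abs.
apply: (IH `|r|%N); [by clear -r0 rm rltm; lia| |rewrite -rN].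
  by clear -r0 rm rltm rz mp; lia.
(* The Euler product of the two representations is divisible by m in each entry. *)
exists (r + a' * qa + b' * qb + c' * qc + d' * qd),
  (qa * b' - qb * a' + qc * d' - qd * c'),
  (qa * c' - qc * a' + qd * b' - qb * d'),
  (qa * d' - qd * a' + qb * c' - qc * b').
apply: (mulfI (mulf_neq0 mN0 mN0)).
transitivity ((m%:Z * p%:Z) * (m%:Z * r)); first by ring.
set e1 := r + _ + _ + _ + _.
have Ee : m%:Z * e1 = a * a' + b * b' + c * c' + d * d'.
  transitivity (m%:Z * r + m%:Z * (e1 - r)); first by ring.
  by rewrite Er /e1 Ea Eb Ec Ed; ring.
transitivity ((m%:Z * e1) ^+ 2 + m%:Z * m%:Z *
  ((qa * b' - qb * a' + qc * d' - qd * c') ^+ 2 +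
   (qa * c' - qc * a' + qd * b' - qb * d') ^+ 2 +
   (qa * d' - qd * a' + qb * c' - qc * b') ^+ 2)); last by ring.
by rewrite Ee E Er Ea Eb Ec Ed; ring.
Qed.

(** Strong induction, splitting off the least prime factor [p]. For odd [p] the descent starts at
    [m * p = i ^ 2 + j ^ 2 + 1], where [i, j <= p./2] ensures [m < p]. *)
Lemma lagrange_four_squares (n : nat) : sum4sq n%:Z.
Proof.
elim/ltn_ind: n => n IH.
have [n1|n1] := leqP n 1.
  by exists n%:Z, 0, 0, 0; case: n n1 {IH} => [|[|]].
have pr_p := pdiv_prime n1; set p := pdiv n in pr_p.
have sp : sum4sq p%:Z.
  have [p2|odd_p] := even_prime pr_p; first by rewrite p2; exists 1, 1, 0, 0.
  have [i [j [ip jp /dvdnP[m Em]]]] := prime_dvd_sum2sq_succ p pr_p odd_p.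
  have p1 := prime_gt1 pr_p.
  apply: (sum4sq_descent p m pr_p).
    suff: (m * p < p * p)%N by rewrite ltn_mul2r; case: m Em => [|m]; lia.
    have : (i ^ 2 <= p./2 ^ 2)%N by rewrite leq_sqr.
    have : (j ^ 2 <= p./2 ^ 2)%N by rewrite leq_sqr.
    rewrite -Em; have -> : (p * p = 4 * p./2 ^ 2 + 4 * p./2 + 1)%N.
      have Ep : p = (2 * p./2 + 1)%N by lia.
      by rewrite {1 2}Ep; ring.
    lia.
  by exists i%:Z, j%:Z, 1, 0; rewrite -PoszM -Em; lia.
have En : n = (n %/ p * p)%N by rewrite divnK // pdiv_dvd.
rewrite En PoszM; apply: sum4sqM => //; apply: IH.
by rewrite ltn_Pdiv // ?prime_gt1 //; lia.
Qed.

(** * Divisibility by 3 and the form [x ^+ 2 + 2 * w ^+ 2] *)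

Lemma sqr_mod3 (x : int) : (x ^+ 2 %% 3)%Z = if (3 %| x)%Z then 0 else 1.
Proof.
have E := divz_eq x 3; set q := (x %/ 3)%Z in E.
have r0 : 0 <= (x %% 3)%Z by apply: modz_ge0.
have r3 : (x %% 3)%Z < 3 by apply: ltz_pmod.
have [|ndv] := ifP; first by lia.
have : (x %% 3)%Z = 1 \/ (x %% 3)%Z = 2 by lia.
case=> Er; rewrite Er in E.
  have -> : x ^+ 2 = (3 * q ^+ 2 + 2 * q) * 3 + 1 by rewrite E; ring.
  lia.
have -> : x ^+ 2 = (3 * q ^+ 2 + 4 * q + 1) * 3 + 1 by rewrite E; ring.
lia.
Qed.

Lemma same_parity_split (x y : int) : (2 %| x - y)%Z ->
  exists s r : int, x = s + r /\ y = s - r.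
Proof. by case/dvdzP=> r Er; exists (y + r), r; split; lia. Qed.

(* Multiplication of [x + w * sqrt (-2)] by [((1 +- sqrt (-2)) / 3) ^ 2], which
   has norm 1; one of the two signs gives coordinates prime to 3. *)
Lemma sqrD2sqr_prime_to3 (x w : int) : (3 %| x)%Z -> (3 %| w)%Z ->
  (x, w) != (0, 0) ->
  exists x' w' : int, [/\ x' ^+ 2 + 2 * w' ^+ 2 = x ^+ 2 + 2 * w ^+ 2,
    ~~ (3 %| x')%Z & ~~ (3 %| w')%Z].
Proof.
have [n] := ubnP (`|x| + `|w|)%N; elim: n x w => // n IH x0 w0 len /dvdzP[x Ex] /dvdzP[w Ew].
rewrite {}Ex {}Ew xpair_eqE in len * => nz.
(* A factor 3 has been divided out; if both quotients are still multiples of 3, the induction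
   hypothesis replaces them. *)
have [y [v [E nd]]] : exists y v : int,
    y ^+ 2 + 2 * v ^+ 2 = x ^+ 2 + 2 * w ^+ 2 /\ ~~ ((3 %| y)%Z && (3 %| v)%Z).
  have [/andP[dx dw]|nd] := boolP ((3 %| x)%Z && (3 %| w)%Z); last by exists x, w.
  case: (IH x w _ dx dw); [lia|rewrite xpair_eqE; lia|].
  by move=> y [v [E ny _]]; exists y, v; split; rewrite ?negb_and ?ny.
(* The new pair is [y + v * sqrt (-2)] times [-1 - 2 * sqrt (-2)] or its conjugate, of norm 9. With
   the conjugate, both coordinates are [- (y + v)] modulo 3, which fails only when [3 %| y + v]. *)
have [d|d] := boolP (3 %| y + v)%Z.
  exists (- y + 4 * v), (- 2 * y - v); split; [|clear -nd d; lia|clear -nd d; lia].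
  by transitivity (9 * (y ^+ 2 + 2 * v ^+ 2)); [|rewrite E]; ring.
exists (- y - 4 * v), (2 * y - v); split; [|clear -nd d; lia|clear -nd d; lia].
by transitivity (9 * (y ^+ 2 + 2 * v ^+ 2)); [|rewrite E]; ring.
Qed.

(** * From four squares to [good] representations, by the number of entries divisible by 3 *)

Definition good (m : int) : Prop := exists u z v t : int,
  m = u ^+ 2 + z ^+ 2 + 2 * v ^+ 2 + 2 * t ^+ 2 /\
  [\/ [/\ ~~ (3 %| z)%Z, ~~ (3 %| v)%Z & ~~ (3 %| t)%Z],
      [/\ ~~ (3 %| u)%Z, ~~ (3 %| v)%Z & ~~ (3 %| t)%Z],
      [/\ ~~ (3 %| u)%Z, ~~ (3 %| z)%Z & ~~ (3 %| t)%Z] |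
      [/\ ~~ (3 %| u)%Z, ~~ (3 %| z)%Z & ~~ (3 %| v)%Z]].

(** Two of [y], [z], [w] have equal parity; they become [s + r] and [s - r], and 3 cannot divide
    both [s] and [r]. *)
Lemma good_sum4sq_0ndvd3 (m x y z w : int) :
  m = x ^+ 2 + y ^+ 2 + z ^+ 2 + w ^+ 2 ->
  ~~ (3 %| x)%Z -> ~~ (3 %| y)%Z -> ~~ (3 %| z)%Z -> ~~ (3 %| w)%Z -> good m.
Proof.
move=> E nx ny nz nw.
have aux (a b c d : int) : m = a ^+ 2 + b ^+ 2 + c ^+ 2 + d ^+ 2 ->
    ~~ (3 %| a)%Z -> ~~ (3 %| b)%Z -> ~~ (3 %| c)%Z -> ~~ (3 %| d)%Z ->
    (2 %| c - d)%Z -> good m.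
  move=> {}E na nb nc nd /same_parity_split[s [r [Ec Ed]]].
  exists a, b, s, r; split; first by rewrite E Ec Ed; ring.
  have [ds|ds] := boolP (3 %| s)%Z; [apply: Or43|apply: Or44]; split=> //.
  by clear -ds nc Ec; lia.
have : [|| (2 %| y - z)%Z, (2 %| y - w)%Z | (2 %| z - w)%Z] by clear; lia.
case/or3P => H.
- by apply: (aux x w y z) => //; rewrite E; ring.
- by apply: (aux x z y w) => //; rewrite E; ring.
- exact: (aux x y z w).
Qed.

(** Pairing two multiples of 3 gives [s] and [r] divisible by 3. The third multiple together with
    [s] or [r] is a nonzero pair, which [sqrD2sqr_prime_to3] makes prime to 3; one multiple of 3 may
    remain. *)
Lemma good_sum4sq_3dvd3 (m x y z w : int) :
  m = x ^+ 2 + y ^+ 2 + z ^+ 2 + w ^+ 2 ->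
  ~~ (3 %| x)%Z -> (3 %| y)%Z -> (3 %| z)%Z -> (3 %| w)%Z ->
  (y, z, w) != (0, 0, 0) -> good m.
Proof.
rewrite !xpair_eqE; move=> E nx dy dz dw nz.
have aux (a b c : int) : m = x ^+ 2 + a ^+ 2 + b ^+ 2 + c ^+ 2 ->
    (3 %| a)%Z -> (3 %| b)%Z -> (3 %| c)%Z ->
    ~~ ((a == 0) && (b == 0) && (c == 0)) -> (2 %| b - c)%Z -> good m.
  move=> {}E da db dc nabc /same_parity_split[s [r [Eb Ec]]].
  have [ds dr] : (3 %| s)%Z /\ (3 %| r)%Z by split; clear -db dc Eb Ec; lia.
  have [asz|ar] : (a, s) != (0, 0) \/ (a, r) != (0, 0).
  - by rewrite !xpair_eqE; clear -nabc Eb Ec; lia.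
  - have [a' [s' [E' na ns]]] := sqrD2sqr_prime_to3 a s da ds asz.
    exists x, a', s', r; split; last by apply: Or44.
    transitivity (x ^+ 2 + (a ^+ 2 + 2 * s ^+ 2) + 2 * r ^+ 2); last by rewrite -E'; ring.
    by rewrite E Eb Ec; ring.
  have [a' [r' [E' na nr]]] := sqrD2sqr_prime_to3 a r da dr ar.
  exists x, a', s, r'; split; last by apply: Or43.
  transitivity (x ^+ 2 + (a ^+ 2 + 2 * r ^+ 2) + 2 * s ^+ 2); last by rewrite -E'; ring.
  by rewrite E Eb Ec; ring.
have : [|| (2 %| y - z)%Z, (2 %| y - w)%Z | (2 %| z - w)%Z] by clear; lia.
case/or3P => H.
- by apply: (aux w y z) => //; [rewrite E; ring|clear -nz; lia].
- by apply: (aux z y w) => //; [rewrite E; ring|clear -nz; lia].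
- by apply: (aux y z w).
Qed.

(** Pairing a multiple of 3 with a non-multiple of the same parity makes [s] and [r] both prime to
    3. If parities forbid this, [x] and [y] are paired: exactly one of [s], [r] is a multiple of 3,
    and it is replaced jointly with [z] or [w]. This is blocked only if it vanishes along with [z]
    and [w], so [x ^+ 2 = y ^+ 2] with [x] odd. *)
Lemma good_sum4sq_2dvd3 (m x y z w : int) :
  m = x ^+ 2 + y ^+ 2 + z ^+ 2 + w ^+ 2 ->
  ~~ (3 %| x)%Z -> ~~ (3 %| y)%Z -> (3 %| z)%Z -> (3 %| w)%Z ->
  [|| (z, w) != (0, 0), x ^+ 2 != y ^+ 2 | (2 %| x)%Z] -> good m.
Proof.
rewrite !xpair_eqE; move=> E nx ny dz dw nz.
have aux (a b c d : int) : m = a ^+ 2 + b ^+ 2 + c ^+ 2 + d ^+ 2 ->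
    ~~ (3 %| a)%Z -> ~~ (3 %| b)%Z -> (3 %| c)%Z -> (3 %| d)%Z ->
    (2 %| a - c)%Z -> good m.
  move=> {}E na nb dc dd /same_parity_split[s [r [Ea Ec]]].
  exists b, d, s, r; split; first by rewrite E Ea Ec; ring.
  by apply: Or42; split=> //; clear -na dc Ea Ec; lia.
have [xz|xz] := boolP (2 %| x - z)%Z; first exact: (aux x y z w).
have [xw|xw] := boolP (2 %| x - w)%Z.
  by apply: (aux x y w z) => //; rewrite E; ring.
have [yz|yz] := boolP (2 %| y - z)%Z.
  by apply: (aux y x z w) => //; rewrite E; ring.
have /same_parity_split[s [r [Ex Ey]]] : (2 %| x - y)%Z by clear -xz yz; lia.
have {}E : m = z ^+ 2 + w ^+ 2 + 2 * s ^+ 2 + 2 * r ^+ 2.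
  by rewrite E Ex Ey; ring.
have aux2 (a b : int) : m = z ^+ 2 + w ^+ 2 + 2 * a ^+ 2 + 2 * b ^+ 2 ->
    (3 %| a)%Z -> ~~ (3 %| b)%Z -> ~~ ((z == 0) && (w == 0) && (a == 0)) -> good m.
  move=> {}E da nb nzwa.
  have [za|wa] : (z, a) != (0, 0) \/ (w, a) != (0, 0).
  - by rewrite !xpair_eqE; clear -nzwa; lia.
  - have [z' [a' [E' nz' na]]] := sqrD2sqr_prime_to3 z a dz da za.
    exists z', w, a', b; split; last by apply: Or42.
    transitivity ((z ^+ 2 + 2 * a ^+ 2) + w ^+ 2 + 2 * b ^+ 2); last by rewrite -E'; ring.
    by rewrite E; ring.
  have [w' [a' [E' nw' na]]] := sqrD2sqr_prime_to3 w a dw da wa.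
  exists z, w', a', b; split; last by apply: Or41.
  transitivity ((w ^+ 2 + 2 * a ^+ 2) + z ^+ 2 + 2 * b ^+ 2); last by rewrite -E'; ring.
  by rewrite E; ring.
have nz' (a : int) : (a == 0 -> x ^+ 2 = y ^+ 2) -> ~~ ((z == 0) && (w == 0) && (a == 0)).
  move=> Ha; apply/negP => /andP[/andP[/eqP z0 /eqP w0] /Ha xy].
  move: nz; rewrite z0 w0 xy !eqxx /= => d2.
  by move: xz; rewrite z0 subr0 d2.
have [ds|ds] := boolP (3 %| s)%Z.
  apply: (aux2 s r) => //; first by clear -ds nx Ex; lia.
  by apply: nz' => /eqP s0; rewrite Ex Ey s0; ring.
apply: (aux2 r s) => //; first by rewrite E; ring.
  by clear -ds nx ny Ex Ey; lia.
by apply: nz' => /eqP r0; rewrite Ex Ey r0; ring.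
Qed.

(** If some non-multiple has the parity of [w], pairing them suffices. Otherwise [x], [y], [z] have
    equal parity, and pairing [x, y] or [y, z] gives one multiple of 3 to be replaced jointly with
    [w]. Both pairings are blocked only if [w = 0] and the three squares agree. *)
Lemma good_sum4sq_1dvd3 (m x y z w : int) :
  m = x ^+ 2 + y ^+ 2 + z ^+ 2 + w ^+ 2 ->
  ~~ (3 %| x)%Z -> ~~ (3 %| y)%Z -> ~~ (3 %| z)%Z -> (3 %| w)%Z ->
  [|| w != 0, x ^+ 2 != y ^+ 2, y ^+ 2 != z ^+ 2 | (2 %| x)%Z] -> good m.
Proof.
move=> E nx ny nz dw nd.
have aux (a b c : int) : m = a ^+ 2 + b ^+ 2 + c ^+ 2 + w ^+ 2 ->
    ~~ (3 %| a)%Z -> ~~ (3 %| b)%Z -> ~~ (3 %| c)%Z ->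
    (2 %| a - w)%Z -> good m.
  move=> {}E na nb nc /same_parity_split[s [r [Ea Ew]]].
  exists b, c, s, r; split; first by rewrite E Ea Ew; ring.
  by apply: Or41; split=> //; clear -na dw Ea Ew; lia.
have [xw|xw] := boolP (2 %| x - w)%Z; first exact: (aux x y z).
have [yw|yw] := boolP (2 %| y - w)%Z.
  by apply: (aux y x z) => //; rewrite E; ring.
have [zw|zw] := boolP (2 %| z - w)%Z.
  by apply: (aux z x y) => //; rewrite E; ring.
have aux2 (a b c : int) : m = a ^+ 2 + b ^+ 2 + c ^+ 2 + w ^+ 2 ->
    ~~ (3 %| a)%Z -> ~~ (3 %| b)%Z -> ~~ (3 %| c)%Z ->
    (2 %| a - b)%Z -> (w != 0) || (a ^+ 2 != b ^+ 2) -> good m.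
  move=> {}E na nb nc /same_parity_split[s [r [Ea Eb]]] nab.
  have {}E : m = w ^+ 2 + c ^+ 2 + 2 * s ^+ 2 + 2 * r ^+ 2.
    by rewrite E Ea Eb; ring.
  have [ds|ds] := boolP (3 %| s)%Z.
    have ws : (w, s) != (0, 0).
      move: nab; rewrite xpair_eqE negb_and; case: eqP => //= _; apply: contraNneq => s0.
      by rewrite Ea Eb s0; apply/eqP; ring.
    have [w' [s' [E' nw ns]]] := sqrD2sqr_prime_to3 w s dw ds ws.
    exists w', c, s', r; split.
      transitivity ((w ^+ 2 + 2 * s ^+ 2) + c ^+ 2 + 2 * r ^+ 2); last by rewrite -E'; ring.
      by rewrite E; ring.
    by apply: Or44.
  have dr : (3 %| r)%Z by clear -ds na nb Ea Eb; lia.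
  have wr : (w, r) != (0, 0).
    move: nab; rewrite xpair_eqE negb_and; case: eqP => //= _; apply: contraNneq => r0.
    by rewrite Ea Eb r0; apply/eqP; ring.
  have [w' [r' [E' nw nr]]] := sqrD2sqr_prime_to3 w r dw dr wr.
  exists w', c, s, r'; split.
    transitivity ((w ^+ 2 + 2 * r ^+ 2) + c ^+ 2 + 2 * s ^+ 2); last by rewrite -E'; ring.
    by rewrite E; ring.
  by apply: Or43.
have xy : (2 %| x - y)%Z by clear -xw yw; lia.
have yz : (2 %| y - z)%Z by clear -zw yw; lia.
have [nxy|xye] := boolP ((w != 0) || (x ^+ 2 != y ^+ 2)); first exact: (aux2 x y z).
apply: (aux2 y z x) => //; first by rewrite E; ring.
move: xye; rewrite negb_or !negbK => /andP[/eqP w0 /eqP xye].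
move: nd; rewrite w0 xye !eqxx /=.
by move: xw; rewrite w0 subr0 => /negPf->; rewrite orbF.
Qed.

(** After pairing two entries, some nonzero [(p, q)] of multiples of 3 is made prime to 3. Undoing
    the pairing gives entries [q' + g] and [q' - g], prime to 3 because [g] is a multiple of 3. *)
Lemma sum4sq_4dvd3 (m x y z w : int) :
  m = x ^+ 2 + y ^+ 2 + z ^+ 2 + w ^+ 2 ->
  (3 %| x)%Z -> (3 %| y)%Z -> (3 %| z)%Z -> (3 %| w)%Z -> m != 0 ->
  exists a b c d : int, [/\ m = a ^+ 2 + b ^+ 2 + c ^+ 2 + d ^+ 2,
    ~~ (3 %| a)%Z, ~~ (3 %| b)%Z, ~~ (3 %| c)%Z & (3 %| d)%Z].
Proof.
move=> E dx dy dz dw m0.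
suff aux (a b c d : int) : m = a ^+ 2 + b ^+ 2 + c ^+ 2 + d ^+ 2 ->
    (3 %| a)%Z -> (3 %| b)%Z -> (3 %| c)%Z -> (3 %| d)%Z -> (2 %| c - d)%Z ->
    exists a b c d : int, [/\ m = a ^+ 2 + b ^+ 2 + c ^+ 2 + d ^+ 2,
      ~~ (3 %| a)%Z, ~~ (3 %| b)%Z, ~~ (3 %| c)%Z & (3 %| d)%Z].
  have : [|| (2 %| y - z)%Z, (2 %| y - w)%Z | (2 %| z - w)%Z] by clear; lia.
  case/or3P => H.
  - by apply: (aux x w y z) => //; rewrite E; ring.
  - by apply: (aux x z y w) => //; rewrite E; ring.
  - exact: (aux x y z w).
move=> {}E da db dc dd /same_parity_split[s [r [Ec Ed]]].
have [ds dr] : (3 %| s)%Z /\ (3 %| r)%Z by split; clear -dc dd Ec Ed; lia.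
have {}E : m = a ^+ 2 + b ^+ 2 + 2 * s ^+ 2 + 2 * r ^+ 2.
  by rewrite E Ec Ed; ring.
have step (p q f g : int) : m = (p ^+ 2 + 2 * q ^+ 2) + f ^+ 2 + 2 * g ^+ 2 ->
    (3 %| p)%Z -> (3 %| q)%Z -> (3 %| f)%Z -> (3 %| g)%Z -> (p, q) != (0, 0) ->
    exists a b c d : int, [/\ m = a ^+ 2 + b ^+ 2 + c ^+ 2 + d ^+ 2,
      ~~ (3 %| a)%Z, ~~ (3 %| b)%Z, ~~ (3 %| c)%Z & (3 %| d)%Z].
  move=> {}E dp dq df dg pq.
  have [p' [q' [E' np nq]]] := sqrD2sqr_prime_to3 p q dp dq pq.
  exists p', (q' + g), (q' - g), f; split=> //; last 2 first.
  - by clear -dg nq; lia.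
  - by clear -dg nq; lia.
  by rewrite E -E'; ring.
have [as0|nas] := eqVneq (a, s) (0, 0); last first.
  by apply: (step a s b r) => //; rewrite E; ring.
apply: (step b r a s) => //; first by rewrite E; ring.
apply: contraNneq m0 => -[b0 r0]; case: as0 => a0 s0.
by rewrite E a0 s0 b0 r0; apply/eqP; ring.
Qed.

(** * Odd squares as nontrivial sums of three squares *)

Lemma dvd3M (x y : int) : (3 %| x * y)%Z = (3 %| x)%Z || (3 %| y)%Z.
Proof. by rewrite !dvdzE abszM Euclid_dvdM. Qed.

Lemma prime_nonsquare (p : nat) (a : int) : prime p -> p%:Z <> a ^+ 2.
Proof.
move=> pr_p E; have {}E : p = (`|a| * `|a|)%N by rewrite -abszM -expr2 -E.
have p1 := prime_gt1 pr_p.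
case/primeP: pr_p => _ /(_ `|a|%N); rewrite E dvdn_mulr // => /(_ isT).
by case/orP => /eqP; nia.
Qed.

(* The three entries are the coordinates of [q i q^*] for a quaternion [q] of
   norm [p]; as [p] is not a square, [q] has two nonzero coordinates, which
   may be taken to be the real part and the coefficient of [j]. *)
Lemma prime_sqr_sum3sq (p : nat) : prime p -> odd p ->
  exists A B C : int, [/\ p%:Z ^+ 2 = A ^+ 2 + B ^+ 2 + C ^+ 2,
    A != 0 & (B, C) != (0, 0)].
Proof.
move=> pr_p odd_p.
have [a [b [c [d [E a0 c0]]]]] : exists a b c d : int,
    [/\ p%:Z = a ^+ 2 + b ^+ 2 + c ^+ 2 + d ^+ 2, a != 0 & c != 0].
  have [a [b [c [d E]]]] := lagrange_four_squares p.
  have nsq := prime_nonsquare p _ pr_p.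
  (* Three vanishing coordinates would make [p] a square; in the remaining cases a permutation
     brings two nonzero ones to the places of [a] and [c]. *)
  have [a0|a0] := eqVneq a 0; have [b0|b0] := eqVneq b 0;
  have [c0|c0] := eqVneq c 0; have [d0|d0] := eqVneq d 0;
  try solve [case: (nsq a); rewrite E b0 c0 d0; ring | case: (nsq b); rewrite E a0 c0 d0; ring
    | case: (nsq c); rewrite E a0 b0 d0; ring | case: (nsq d); rewrite E a0 b0 c0; ring];
  solve [ by exists a, b, c, d | exists a, b, d, c; split=> //; rewrite E; ring
        | exists a, c, b, d; split=> //; rewrite E; ring
        | exists b, a, c, d; split=> //; rewrite E; ring
        | exists b, a, d, c; split=> //; rewrite E; ring
        | exists c, a, d, b; split=> //; rewrite E; ring ].
pose A : int := a ^+ 2 + b ^+ 2 - c ^+ 2 - d ^+ 2.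
exists A, (2 * (a * c + b * d)), (2 * (a * d - b * c)).
have Ep : p%:Z ^+ 2 = A ^+ 2 + (2 * (a * c + b * d)) ^+ 2 + (2 * (a * d - b * c)) ^+ 2.
  by rewrite E /A; ring.
split=> //.
  have : p%:Z = A + 2 * (c ^+ 2 + d ^+ 2) by rewrite E /A; ring.
  by clear -odd_p => Epp; apply/eqP => A0; rewrite A0 in Epp; lia.
rewrite xpair_eqE; apply/negP => /andP[/eqP B0 /eqP C0].
have gt0 (x y : int) : x != 0 -> 0 < x ^+ 2 + y ^+ 2.
  by move=> x0; rewrite ltr_pwDl ?sqr_ge0 // exprn_even_gt0.
(* If [B = C = 0], this product vanishes although both factors are positive. *)
have : 4 * ((a ^+ 2 + b ^+ 2) * (c ^+ 2 + d ^+ 2)) =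
    (2 * (a * c + b * d)) ^+ 2 + (2 * (a * d - b * c)) ^+ 2 by ring.
rewrite B0 C0 expr0n addr0 => /eqP; rewrite mulf_eq0 /= mulf_eq0.
by have := gt0 _ b a0; have := gt0 _ d c0; lia.
Qed.

(** A representation of [p ^ 2], for a prime factor [p] of [t], is scaled by [t / p]. As [t ^ 2] is
    1 modulo 3, exactly one entry is prime to 3, and it is moved to the front. *)
Lemma sqr_sum3sq (t : nat) : odd t -> ~~ (3 %| t)%N -> (1 < t)%N ->
  exists A B C : int, [/\ t%:Z ^+ 2 = A ^+ 2 + B ^+ 2 + C ^+ 2,
    ~~ (3 %| A)%Z, (3 %| B)%Z, (3 %| C)%Z & (B, C) != (0, 0)].
Proof.
move=> odd_t nt t1; have pr_p := pdiv_prime t1.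
have [k Ek] := dvdnP (pdiv_dvd t); set p := pdiv t in pr_p Ek.
have odd_p : odd p by move: odd_t; rewrite Ek oddM => /andP[].
have nk : k%:Z != 0 by move: t1; rewrite Ek; case: (k).
have [A [B [C [E A0 BC0]]]] := prime_sqr_sum3sq p pr_p odd_p.
have {}E : t%:Z ^+ 2 = (k%:Z * A) ^+ 2 + (k%:Z * B) ^+ 2 + (k%:Z * C) ^+ 2.
  by rewrite Ek PoszM exprMn E; ring.
have {}A0 : k%:Z * A != 0 by rewrite mulf_neq0.
have {}BC0 : (k%:Z * B, k%:Z * C) != (0, 0).
  by move: BC0; rewrite !xpair_eqE !mulf_eq0 (negPf nk).
have : ((k%:Z * A) ^+ 2 + (k%:Z * B) ^+ 2 + (k%:Z * C) ^+ 2 = 1 %[mod 3])%Z.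
  by rewrite -E sqr_mod3 ifN.
move: (k%:Z * A) (k%:Z * B) (k%:Z * C) E A0 BC0 => {A B C}A B C E A0 BC0 Em.
have := sqr_mod3 A; have := sqr_mod3 B; have := sqr_mod3 C.
move: BC0; rewrite xpair_eqE.
have [dA|dA] := boolP (3 %| A)%Z; have [dB|dB] := boolP (3 %| B)%Z;
  have [dC|dC] := boolP (3 %| C)%Z; move=> BC0 eC eB eA;
  try (exfalso; clear -Em eA eB eC; lia).
- exists C, A, B; split=> //; first by rewrite E; ring.
  by rewrite xpair_eqE (negPf A0).
- exists B, A, C; split=> //; first by rewrite E; ring.
  by rewrite xpair_eqE (negPf A0).
- by exists A, B, C; rewrite xpair_eqE.
Qed.

(** * The exceptional values [k * t ^+ 2] and the conclusion for all [m >= 4] *)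

Lemma good_sqr (t : nat) : ~~ (3 %| t)%N -> (1 < t)%N -> good (t%:Z ^+ 2).
Proof.
move=> nt t1; have [odd_t|even_t] := boolP (odd t).
  have [A [B [C [E nA dB dC nBC]]]] := sqr_sum3sq t odd_t nt t1.
  apply: (good_sum4sq_3dvd3 _ A B C 0) => //; first by rewrite E; ring.
  by rewrite xpair_eqE eqxx andbT.
have [k Ek] : exists k : int, t%:Z = 2 * k by exists t./2%:Z; lia.
have nk : ~~ (3 %| k)%Z by clear -Ek nt; lia.
by apply: (good_sum4sq_0ndvd3 _ k k k k) => //; rewrite Ek; ring.
Qed.

Lemma good_2sqr (t : nat) : odd t -> ~~ (3 %| t)%N -> (1 < t)%N ->
  good (2 * t%:Z ^+ 2).
Proof.
move=> odd_t nt t1.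
have [A [B [C [E nA dB dC nBC]]]] := sqr_sum3sq t odd_t nt t1.
apply: (good_sum4sq_2dvd3 _ t A B C) => //; last by rewrite nBC.
by rewrite -!addrA (addrA (A ^+ 2)) -E; ring.
Qed.

Lemma good_3sqr (t : nat) : odd t -> ~~ (3 %| t)%N -> (1 < t)%N ->
  good (3 * t%:Z ^+ 2).
Proof.
move=> odd_t nt t1.
have [A [B [C [E nA dB dC nBC]]]] := sqr_sum3sq t odd_t nt t1.
apply: (good_sum4sq_1dvd3 _ (A + B + C) (A - B) (A - C) (B - C)).
- by rewrite E; ring.
- by clear -nA dB dC; lia.
- by clear -nA dB; lia.
- by clear -nA dC; lia.
- by clear -dB dC; lia.
have [BC|_] /= := eqVneq (B - C) 0; last by [].
have {}BC : C = B by apply/esym/eqP; rewrite -subr_eq0 BC.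
rewrite {C}BC xpair_eqE andbb in E dC nBC *.
apply/orP; left; apply: contraNneq nBC => EAB.
(* With [B = C], equality of the first two squares leaves [B = 0], excluded by nontriviality, or
   [B = - 2 * A], which would make 3 divide [A]. *)
have : 3 * B * (2 * A + B) = 0.
  transitivity ((A + B + B) ^+ 2 - (A - B) ^+ 2); first by ring.
  by rewrite EAB subrr.
move/eqP; rewrite !mulf_eq0 /= => /orP[] // /eqP AB.
have {}AB : B = - (2 * A) by clear -AB; lia.
have : (3 %| A)%Z by clear -AB dB; lia.
by rewrite (negPf nA).
Qed.

(** [c1], [c2], [c3] treat one, two, three entries prime to 3, and four multiples of 3 reduce to
    [c3]. In the exceptional cases [m = k * t ^+ 2] with [k <= 3], so [m >= 4] forces [t > 1]. *)
Lemma good_ge4 (n : nat) : good (n%:Z + 4).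
Proof.
set m := n%:Z + 4; have m4 : 4 <= m by rewrite /m; lia.
have [a [b [c [d E]]]] : sum4sq m by rewrite /m -PoszD; apply: lagrange_four_squares.
have c1 (x y z w : int) : m = x ^+ 2 + y ^+ 2 + z ^+ 2 + w ^+ 2 ->
    ~~ (3 %| x)%Z -> (3 %| y)%Z -> (3 %| z)%Z -> (3 %| w)%Z -> good m.
  move=> {}E nx dy dz dw.
  have [[y0 z0 w0]|nz] := eqVneq (y, z, w) (0, 0, 0); last first.
    exact: (good_sum4sq_3dvd3 m x y z w).
  have {}E : m = `|x|%N%:Z ^+ 2 by rewrite E y0 z0 w0 abszE real_normK ?num_real //; ring.
  rewrite E; apply: good_sqr; first by move: nx; rewrite dvdzE.
  by rewrite ltnNge; apply/negP => x1; clear -E m4 x1; nia.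
have c2 (x y z w : int) : m = x ^+ 2 + y ^+ 2 + z ^+ 2 + w ^+ 2 ->
    ~~ (3 %| x)%Z -> ~~ (3 %| y)%Z -> (3 %| z)%Z -> (3 %| w)%Z -> good m.
  move=> {}E nx ny dz dw.
  have [/(good_sum4sq_2dvd3 m x y z w E nx ny dz dw) //|] :=
    boolP [|| (z, w) != (0, 0), x ^+ 2 != y ^+ 2 | (2 %| x)%Z].
  rewrite !negb_or !negbK => /and3P[/eqP[z0 w0] /eqP xy odd_x].
  have {}E : m = 2 * `|x|%N%:Z ^+ 2 by rewrite E -xy z0 w0 abszE real_normK ?num_real //; ring.
  rewrite E; apply: good_2sqr; [|by move: nx; rewrite dvdzE|].
    by clear -odd_x; lia.
  by rewrite ltnNge; apply/negP => x1; clear -E m4 x1; nia.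
have c3 (x y z w : int) : m = x ^+ 2 + y ^+ 2 + z ^+ 2 + w ^+ 2 ->
    ~~ (3 %| x)%Z -> ~~ (3 %| y)%Z -> ~~ (3 %| z)%Z -> (3 %| w)%Z -> good m.
  move=> {}E nx ny nz dw.
  have [/(good_sum4sq_1dvd3 m x y z w E nx ny nz dw) //|] :=
    boolP [|| w != 0, x ^+ 2 != y ^+ 2, y ^+ 2 != z ^+ 2 | (2 %| x)%Z].
  rewrite !negb_or !negbK => /and4P[/eqP w0 /eqP xy /eqP yz odd_x].
  have {}E : m = 3 * `|x|%N%:Z ^+ 2 by rewrite E -yz -xy w0 abszE real_normK ?num_real //; ring.
  rewrite E; apply: good_3sqr; [|by move: nx; rewrite dvdzE|].
    by clear -odd_x; lia.
  by rewrite ltnNge; apply/negP => x1; clear -E m4 x1; nia.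
have [da|da] := boolP (3 %| a)%Z; have [db|db] := boolP (3 %| b)%Z;
have [dc|dc] := boolP (3 %| c)%Z; have [dd|dd] := boolP (3 %| d)%Z.
- have [|x [y [z [w [{}E ? ? ? ?]]]]] := sum4sq_4dvd3 m a b c d E da db dc dd.
    by clear -m4; lia.
  exact: (c3 x y z w).
- by apply: (c1 d a b c) => //; rewrite E; ring.
- by apply: (c1 c a b d) => //; rewrite E; ring.
- by apply: (c2 c d a b) => //; rewrite E; ring.
- by apply: (c1 b a c d) => //; rewrite E; ring.
- by apply: (c2 b d a c) => //; rewrite E; ring.
- by apply: (c2 b c a d) => //; rewrite E; ring.
- by apply: (c3 b c d a) => //; rewrite E; ring.
- exact: (c1 a b c d).
- by apply: (c2 a d b c) => //; rewrite E; ring.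
- by apply: (c2 a c b d) => //; rewrite E; ring.
- by apply: (c3 a c d b) => //; rewrite E; ring.
- exact: (c2 a b c d).
- by apply: (c3 a b d c) => //; rewrite E; ring.
- exact: (c3 a b c d).
- exact: (good_sum4sq_0ndvd3 m a b c d).
Qed.

(** * Back to octagonal numbers *)

(** As [u + 2 * v] and [u - v] agree modulo 3, the last condition makes both prime to 3. It is
    reached by changing the sign of [v] if necessary, once [u] and [v] are not both multiples of
    3. *)
Lemma good_ndvd3 (m : int) : good m -> exists u z v t : int,
  [/\ m = u ^+ 2 + z ^+ 2 + 2 * v ^+ 2 + 2 * t ^+ 2,
    ~~ (3 %| z)%Z, ~~ (3 %| t)%Z & ~~ (3 %| u - v)%Z].
Proof.
move=> [u [z [v [t [E H]]]]].
have {H} [u' [z' [v' [t' [{}E nz nt nuv]]]]] : exists u z v t : int,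
    [/\ m = u ^+ 2 + z ^+ 2 + 2 * v ^+ 2 + 2 * t ^+ 2,
      ~~ (3 %| z)%Z, ~~ (3 %| t)%Z & ~~ ((3 %| u)%Z && (3 %| v)%Z)].
  case: H => -[h1 h2 h3].
  - by exists u, z, v, t; rewrite (negPf h2) andbF.
  - by exists z, u, v, t; rewrite (negPf h2) andbF E (addrC (z ^+ 2)).
  - by exists u, z, v, t; rewrite (negPf h1).
  - by exists u, z, t, v; rewrite (negPf h1) E -!addrA (addrC (2 * t ^+ 2)).
have [d|d] := boolP (3 %| u' - v')%Z; last by exists u', z', v', t'.
exists u', z', (- v'), t'; split=> //; first by rewrite sqrrN.
by clear -d nuv; lia.
Qed.

Lemma P8_ndvd3 (x : int) : ~~ (3 %| x)%Z -> exists y : int, 3 * P8 y + 1 = x ^+ 2.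
Proof.
move=> nx; have [[k Ek]|[k Ek]] : (exists k, x = 3 * k - 1) \/ (exists k, x = 1 - 3 * k).
- have [d|d] := boolP (3 %| x + 1)%Z.
    by left; exists ((x + 1) %/ 3)%Z; lia.
  by right; exists (- ((x - 1) %/ 3)%Z); lia.
- by exists k; rewrite Ek /P8; ring.
- by exists k; rewrite Ek /P8; ring.
Qed.

Theorem theorem2p3 :
  (forall n : nat, exists x y z t : int,
     P8 x + 2 * P8 y + 3 * P8 z + 6 * P8 t = n%:Z)
  /\ universal [tuple 1%N; 2%N; 3%N; 6%N].
Proof.
have main (n : nat) : exists x y z t : int,
    P8 x + 2 * P8 y + 3 * P8 z + 6 * P8 t = n%:Z.
  have [u [z [v [t [E nz nt nuv]]]]] := good_ndvd3 _ (good_ge4 n).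
  have [x' Ex] : exists x' : int, 3 * P8 x' + 1 = (u + 2 * v) ^+ 2.
    by apply: P8_ndvd3; clear -nuv; lia.
  have [y' Ey] := P8_ndvd3 _ nuv.
  have [z' Ez] := P8_ndvd3 _ nz.
  have [t' Et] := P8_ndvd3 _ nt.
  (* The shift is [12 = 1 + 2 + 3 + 6], the sum of the coefficients; [3 * n + 12 = 3 * (n + 4)]
     explains [m = n + 4]. *)
  exists x', y', z', t'; apply: (@mulfI _ 3) => //; apply: (@addIr _ 12).
  transitivity ((3 * P8 x' + 1) + 2 * (3 * P8 y' + 1) + 3 * (3 * P8 z' + 1)
    + 6 * (3 * P8 t' + 1)); first by ring.
  transitivity (3 * (n%:Z + 4)); last by ring.
  by rewrite Ex Ey Ez Et E; ring.
split=> // n; have [x [y [z [t E]]]] := main n.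
exists [tuple x; y; z; t]; rewrite -E /Phi !big_ord_recl big_ord0.
by rewrite !(tnth_nth 0) /= mul1r addr0 !addrA.
Qed.
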